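(* Let $M,m$ be coprime positive integers, $m_2\in\mathbf Z$ with $0\le m_2\le m$, and let $\heartsuit\in\{\mathrm{I},\mathrm{II},\mathrm{III},\mathrm{IV}\}$ and integers $(k_1,k_2)$ be in the admissible range for type $\heartsuit$ (see context). Write $N^{(\pm)}_\heartsuit=\big[\widehat R^{(\pm)}\cdot\mathrm{ch}^{(\pm)}_{L(\Lambda^{(M)(m,m_2)(\heartsuit)}_{k_1,k_2})}\big](\tau,z_1,z_2,t)$. Put $(c,\varepsilon)=((-1)^{m_2+1},\frac12)$ for the sign $+$ and $(c,\varepsilon)=(1,0)$ for the sign $-$. Then, for both signs: (i) $N^{(\pm)}_{\mathrm I}=c\,e^{\frac{2\pi im}M[t+(k_1+k_2)z_1-k_1z_2]}q^{\frac mMk_1(k_1+k_2)}\,\Phi^{(A(1|1))[m,-m_2+1]}(M\tau,\ z_1+k_1\tau+\varepsilon,\ -z_2+(k_1+k_2)\tau-\varepsilon,\ 0)$; (ii) $N^{(\pm)}_{\mathrm{II}}=c\,e^{\frac{2\pi im}M[t-(k_1+k_2)z_1+k_1z_2]}q^{\frac mMk_1(k_1+k_2)}\,\Phi^{(A(1|1))[m,-m_2+1]}(M\tau,\ -z_1+k_1\tau+\varepsilon,\ z_2+(k_1+k_2)\tau-\varepsilon,\ 0)$; (iii) $N^{(\pm)}_{\mathrm{III}}=c\,e^{\frac{2\pi im}M[t+k_1z_1-(k_1+k_2)z_2]}q^{\frac mMk_1(k_1+k_2)}\,\Phi^{(A(1|1))[m,-m_2+1]}(M\tau,\ -z_2+k_1\tau+\varepsilon,\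 z_1+(k_1+k_2)\tau-\varepsilon,\ 0)$; (iv) $N^{(\pm)}_{\mathrm{IV}}=c\,e^{\frac{2\pi im}M[t-k_1z_1+(k_1+k_2)z_2]}q^{\frac mMk_1(k_1+k_2)}\,\Phi^{(A(1|1))[m,-m_2+1]}(M\tau,\ z_2+k_1\tau+\varepsilon,\ -z_1+(k_1+k_2)\tau-\varepsilon,\ 0)$.
   Context: Functions. $q=e^{2\pi i\tau}$. For $m\in\mathbf Z_{>0}$, $s\in\mathbf Z$: $\Phi^{(A(1|1))[m,s]}_1(\tau,z_1,z_2,t)=e^{-2\pi imt}\sum_{j\in\mathbf Z}\frac{e^{2\pi imj(z_1+z_2)+2\pi isz_1}q^{mj^2+sj}}{(1-e^{2\pi iz_1}q^j)^2}$, $\Phi^{(A(1|1))[m,s]}_2(\tau,z_1,z_2,t)=e^{-2\pi imt}\sum_{j\in\mathbf Z}\frac{e^{-2\pi imj(z_1+z_2)-2\pi isz_2}q^{mj^2+sj}}{(1-e^{-2\pi iz_2}q^j)^2}$, $\Phi^{(A(1|1))[m,s]}=\Phi^{(A(1|1))[m,s]}_1-\Phi^{(A(1|1))[m,s]}_2$. Affine superalgebra. $\widehat A(1,1)$ is the affine Lie superalgebra of $sl(2|2)/\mathbf CI$ with simple roots $\alpha_0,\alpha_2$ (even), $\alpha_1,\alpha_3$ (odd), and $(\alpha_0|\alpha_0)=2$, $(\alpha_2|\alpha_2)=-2$, $(\alpha_1|\alpha_1)=(\alpha_3|\alpha_3)=(\alpha_1|\alpha_3)=(\alpha_0|\alpha_2)=0$,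 $(\alpha_0|\alpha_1)=(\alpha_0|\alpha_3)=-1$, $(\alpha_1|\alpha_2)=(\alpha_2|\alpha_3)=1$ (so $\alpha_1,\alpha_3$ coincide as functions on the Cartan subalgebra). $\delta=\sum_{i=0}^3\alpha_i$, $\theta=\alpha_1+\alpha_2+\alpha_3$, $(\Lambda_0|\alpha_j)=\delta_{j,0}$, $(\Lambda_0|\Lambda_0)=0$, $\rho=-\frac12(\alpha_1+\alpha_3)$, dual Coxeter number $0$. The Cartan subalgebra is identified with its dual via $(\cdot|\cdot)$, with coordinates $(\tau,z_1,z_2,t)=2\pi i(-\tau\Lambda_0+z+t\delta)$, $z=-\frac{z_1-z_2}2(\alpha_1+\alpha_3)-z_1\alpha_2$; thus $e^{-\alpha_1}=e^{-\alpha_3}=e^{2\pi iz_1}$, $e^{-\alpha_2}=e^{-2\pi i(z_1+z_2)}$, $e^{\Lambda_0}=e^{2\pi it}$, $e^{-\delta}=q$. Put $t_\alpha(\lambda)=\lambda+(\lambda|\delta)\alpha-\{\frac{(\alpha|\alpha)}2(\lambda|\delta)+(\lambda|\alpha)\}\delta$, $r_\theta(\lambda)=\lambda-(\lambda|\theta)\theta$, $r_{\alpha_2}(\lambda)=\lambda+(\lambda|\alpha_2)\alpha_2$, and $w.\lambda=w(\lambda+\rho)-\rho$. Characters. All characters are normalized (super)characters ($+$: character, $-$: supercharacter), $\widehat R^{(\pm)}$ is the (super)denominator, and ''numerator'' means the product $\widehat R^{(\pm)}\mathrm{ch}^{(\pm)}$. They are given by the following formulas. For $0\le m_2\le m$ let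 $\Lambda^{(m,m_2)}=m\Lambda_0+\frac{m_2}2(\alpha_1+\alpha_3)$ and $F^{(\pm)}=\sum_{j\in\mathbf Z}t_{j\theta}\Big(\frac{e^{\Lambda^{(m,m_2)}+\rho}}{(1\pm e^{-\alpha_1})(1\pm e^{-\alpha_3})}\Big)$; then $\widehat R^{(\pm)}\mathrm{ch}^{(\pm)}_{L(\Lambda^{(m,m_2)})}=F^{(\pm)}-r_\theta F^{(\pm)}$. With $\beta[b_1,b_2]:=-\frac{b_1-b_2}2(\alpha_1+\alpha_3)-b_1\alpha_2$, the types and their admissible ranges are: (I) $\overline y=1$, $\beta=\beta[k_1,-(k_1+k_2)]$, $k_1,k_2\ge0$, $2k_1+k_2\le M-1$; (II) $\overline y=r_\theta r_{\alpha_2}$, $\beta=\beta[-k_1,k_1+k_2]$, $k_1,k_2\ge1$, $2k_1+k_2\le M$; (III) $\overline y=r_{\alpha_2}$, $\beta=\beta[k_1+k_2,-k_1]$, $k_1\ge0$, $k_2\ge1$, $2k_1+k_2\le M-1$; (IV) $\overline y=r_\theta$, $\beta=\beta[-(k_1+k_2),k_1]$, $k_1\ge1$, $k_2\ge0$, $2k_1+k_2\le M$. The principal admissible weight is $\Lambda^{(M)(m,m_2)(\heartsuit)}_{k_1,k_2}=(t_\beta\overline y).(\Lambda^{(m,m_2)}-(M-1)\frac mM\Lambda_0)$ and its irreducible highest weight module has $[\widehat R^{(\pm)}\mathrm{ch}^{(\pm)}_{L(\Lambda^{(M)(m,m_2)(\heartsuit)}_{k_1,k_2})}](\tau,z,t)=[\widehat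 R^{(\pm)}\mathrm{ch}^{(\pm)}_{L(\Lambda^{(m,m_2)})}]\big(M\tau,\overline y^{-1}(z+\tau\beta),\frac1M(t+(z|\beta)+\frac{\tau|\beta|^2}2)\big)$. *)

(* Defs.v *)
From HB Require Import structures.
From mathcomp Require Import all_boot all_order all_algebra.
From mathcomp Require Import complex.
From mathcomp Require Import all_classical all_reals all_analysis.
From mathcomp Require Import showcase.summability.
From mathcomp Require Import ring.

Set Implicit Arguments.
Unset Strict Implicit.
Unset Printing Implicit Defensive.

Import Order.TTheory GRing.Theory Num.Theory.
Import numFieldNormedType.Exports.
Local Open Scope ring_scope.
Local Open Scope complex_scope.

Section ComplexFunctions.
Variable R : realType.
Local Notation C := (R[i]).

Definition cexp (z : C) : C :=
  (expR (complex.Re z))%:C * (cos (complex.Im z) +i* sin (complex.Im z)).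

Definition twopii : C := (2 * pi)%:C * 'i.

(* e2pi x = exp (2 pi i x); with q = exp (2 pi i tau), q ^ x is e2pi (tau * x). *)
Definition e2pi (x : C) : C := cexp (twopii * x).

(* Unconditional summation over Z: limit along the finite subsets of Z. *)
Definition sumZ (f : int -> C) : C := @summability.sum int C C^o f.

End ComplexFunctions.

Section MockTheta.
Variable R : realType.
Local Notation C := (R[i]).

Definition Phi1 (m : nat) (s : int) (tau z1 z2 t : C) : C :=
  e2pi (- (m%:R * t)) *
  sumZ (fun j : int =>
    e2pi (m%:R * j%:~R * (z1 + z2) + s%:~R * z1)
    * e2pi (tau * (m%:R * j%:~R ^+ 2 + s%:~R * j%:~R))
    / (1 - e2pi z1 * e2pi (tau * j%:~R)) ^+ 2).

Definition Phi2 (m : nat) (s : int) (tau z1 z2 t : C) : C :=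
  e2pi (- (m%:R * t)) *
  sumZ (fun j : int =>
    e2pi (- (m%:R * j%:~R * (z1 + z2)) - s%:~R * z2)
    * e2pi (tau * (m%:R * j%:~R ^+ 2 + s%:~R * j%:~R))
    / (1 - e2pi (- z2) * e2pi (tau * j%:~R)) ^+ 2).

Definition Phi (m : nat) (s : int) (tau z1 z2 t : C) : C :=
  Phi1 m s tau z1 z2 t - Phi2 m s tau z1 z2 t.

End MockTheta.

(* The Cartan subalgebra of the affine superalgebra of sl(2|2)/CI is
   4-dimensional and is identified with its dual by the bilinear form.
   Coordinates are taken in the basis (alpha_0, alpha_1, alpha_2, Lambda_0);
   alpha_1 and alpha_3 are the same linear function on it. *)
Section Cartan.
Variable R : realType.
Local Notation C := (R[i]).

Definition cartan := 'rV[C]_4.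

Definition alpha0 : cartan := delta_mx 0 0.
Definition alpha1 : cartan := delta_mx 0 1.
Definition alpha2 : cartan := delta_mx 0 2.
Definition alpha3 : cartan := alpha1.
Definition Lambda0 : cartan := delta_mx 0 3.

Definition gram : 'M[C]_4 := \matrix_(i, j) nth 0 (nth [::]
  [:: [::  2; -1;  0; 1 ];
      [:: -1;  0;  1; 0 ];
      [::  0;  1; -2; 0 ];
      [::  1;  0;  0; 0 ] ] i) j.

Definition form (x y : cartan) : C := (x *m gram *m y^T) 0 0.

Definition delta : cartan := alpha0 + alpha1 + alpha2 + alpha3.
Definition theta : cartan := alpha1 + alpha2 + alpha3.
Definition rho : cartan := - (1 / 2) *: (alpha1 + alpha3).

(* Serves both for the point z of coordinates (z1, z2) and for the shift
   beta[b1, b2], which are given by the same formula. *)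
Definition zvec (z1 z2 : C) : cartan :=
  - ((z1 - z2) / 2) *: (alpha1 + alpha3) - z1 *: alpha2.

Definition hpoint (tau : C) (z : cartan) (t : C) : cartan :=
  twopii R *: (- tau *: Lambda0 + z + t *: delta).

Definition expw (lam h : cartan) : C := cexp (form lam h).

Definition transl (a lam : cartan) : cartan :=
  lam + form lam delta *: a
  - (form a a / 2 * form lam delta + form lam a) *: delta.
Definition refl_theta (lam : cartan) : cartan := lam - form lam theta *: theta.
Definition refl_alpha2 (lam : cartan) : cartan := lam + form lam alpha2 *: alpha2.

Definition dot (w : cartan -> cartan) (lam : cartan) : cartan :=
  w (lam + rho) - rho.

Lemma formDl x y z : form (x + y) z = form x z + form y z.
Proof. by rewrite /form !mulmxDl mxE. Qed.
Lemma formZl a x z : form (a *: x) z = a * form x z.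
Proof. by rewrite /form -!scalemxAl mxE. Qed.
Lemma formDr x y z : form x (y + z) = form x y + form x z.
Proof. by rewrite /form linearD mulmxDr mxE. Qed.
Lemma formZr a x z : form x (a *: z) = a * form x z.
Proof. by rewrite /form linearZ /= -scalemxAr mxE. Qed.
Lemma formNl x z : form (- x) z = - form x z.
Proof. by rewrite -scaleN1r formZl mulN1r. Qed.
Lemma formNr x z : form x (- z) = - form x z.
Proof. by rewrite -scaleN1r formZr mulN1r. Qed.

Lemma form_delta i j : form (delta_mx 0 i) (delta_mx 0 j) = gram i j.
Proof. by rewrite /form -rowE trmx_delta -colE !mxE. Qed.

Lemma formE :
  [/\ [/\ form alpha0 alpha0 = 2, form alpha0 alpha1 = -1,
          form alpha0 alpha2 = 0, form alpha0 alpha3 = -1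
        & form alpha0 Lambda0 = 1],
      [/\ form alpha1 alpha0 = -1, form alpha1 alpha1 = 0,
          form alpha1 alpha2 = 1, form alpha1 alpha3 = 0
        & form alpha1 Lambda0 = 0],
      [/\ form alpha2 alpha0 = 0, form alpha2 alpha1 = 1,
          form alpha2 alpha2 = -2, form alpha2 alpha3 = 1
        & form alpha2 Lambda0 = 0],
      [/\ form alpha3 alpha0 = -1, form alpha3 alpha1 = 0,
          form alpha3 alpha2 = 1, form alpha3 alpha3 = 0
        & form alpha3 Lambda0 = 0]
    & [/\ form Lambda0 alpha0 = 1, form Lambda0 alpha1 = 0,
          form Lambda0 alpha2 = 0, form Lambda0 alpha3 = 0
        & form Lambda0 Lambda0 = 0]].
Proof. by split; split; rewrite form_delta mxE. Qed.

Let formS := (formDl, formDr, formNl, formNr, formZl, formZr).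

Lemma refl_thetaK : involutive refl_theta.
Proof.
have th : form theta theta = 2.
  case: formE => _ [_ f11 f12 f13 _] [_ f21 f22 f23 _] [_ f31 f32 f33 _] _.
  rewrite /theta !formS ?(f11, f12, f13, f21, f22, f23, f31, f32, f33).
  by ring.
by move=> x; rewrite /refl_theta formDl formNl formZl th; apply/rowP => i; rewrite !mxE; ring.
Qed.

Lemma refl_alpha2K : involutive refl_alpha2.
Proof.
have a2 : form alpha2 alpha2 = -2 by case: formE => _ _ [].
by move=> x; rewrite /refl_alpha2 formDl formZl a2; apply/rowP => i; rewrite !mxE; ring.
Qed.

Lemma expw_hpoint tau z1 z2 t (h := hpoint tau (zvec z1 z2) t) :
  [/\ expw (- alpha1) h = e2pi z1, expw (- alpha3) h = e2pi z1,
      expw (- alpha2) h = e2pi (- (z1 + z2)), expw Lambda0 h = e2pi t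
    & expw (- delta) h = e2pi tau].
Proof.
case: formE => [[f00 f01 f02 f03 f0L] [f10 f11 f12 f13 f1L]
  [f20 f21 f22 f23 f2L] [f30 f31 f32 f33 f3L] [fL0 fL1 fL2 fL3 fLL]].
rewrite /h /hpoint /zvec /expw /e2pi /delta; split; congr cexp; rewrite !formS;
  rewrite ?(f00, f01, f02, f03, f0L, f10, f11, f12, f13, f1L) ?(f20, f21, f22,
    f23, f2L, f30, f31, f32, f33, f3L, fL0, fL1, fL2, fL3, fLL); by field.
Qed.

End Cartan.

Variant charsign := Plus | Minus.

Variant heart := TypeI | TypeII | TypeIII | TypeIV.

Definition in_range (ty : heart) (M : nat) (k1 k2 : int) : bool :=
  match ty with
  | TypeI   => [&& 0 <= k1, 0 <= k2 & 2 * k1 + k2 <= M%:Z - 1]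
  | TypeII  => [&& 1 <= k1, 1 <= k2 & 2 * k1 + k2 <= M%:Z]
  | TypeIII => [&& 0 <= k1, 1 <= k2 & 2 * k1 + k2 <= M%:Z - 1]
  | TypeIV  => [&& 1 <= k1, 0 <= k2 & 2 * k1 + k2 <= M%:Z]
  end.

Section Characters.
Variable R : realType.
Local Notation C := (R[i]).
Local Notation H := (cartan R).

Definition sgnC (sg : charsign) : C := if sg is Plus then 1 else -1.

Definition ybar (ty : heart) : H -> H :=
  match ty with
  | TypeI => id
  | TypeII => @refl_theta R \o @refl_alpha2 R
  | TypeIII => @refl_alpha2 R
  | TypeIV => @refl_theta R
  end.

Definition ybar_inv (ty : heart) : H -> H :=
  match ty with
  | TypeI => id
  | TypeII => @refl_alpha2 R \o @refl_theta R
  | TypeIII => @refl_alpha2 R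
  | TypeIV => @refl_theta R
  end.

Lemma ybarK ty : cancel (ybar ty) (ybar_inv ty).
Proof.
by case: ty => x //=; rewrite ?refl_thetaK ?refl_alpha2K.
Qed.

Lemma ybar_invK ty : cancel (ybar_inv ty) (ybar ty).
Proof.
by case: ty => x //=; rewrite ?refl_alpha2K ?refl_thetaK.
Qed.

Definition beta (ty : heart) (k1 k2 : int) : H :=
  match ty with
  | TypeI   => zvec k1%:~R (- (k1 + k2))%:~R
  | TypeII  => zvec (- k1)%:~R (k1 + k2)%:~R
  | TypeIII => zvec (k1 + k2)%:~R (- k1)%:~R
  | TypeIV  => zvec (- (k1 + k2))%:~R k1%:~R
  end.

Definition Lam (m : nat) (m2 : int) : H :=
  m%:R *: Lambda0 R + (m2%:~R / 2) *: (alpha1 R + alpha3 R).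

Definition Lam_adm (M m : nat) (m2 : int) (ty : heart) (k1 k2 : int) : H :=
  dot (transl (beta ty k1 k2) \o ybar ty)
    (Lam m m2 - ((M%:R - 1) * (m%:R / M%:R)) *: Lambda0 R).

Definition odd_factor (sg : charsign) (w : H -> H) (h : H) : C :=
  (1 + sgnC sg * expw (- w (alpha1 R)) h)
  * (1 + sgnC sg * expw (- w (alpha3 R)) h).

(* w (F^(+-)): a linear map w sends e^lambda to e^(w lambda). *)
Definition wF (sg : charsign) (m : nat) (m2 : int) (w : H -> H) (h : H) : C :=
  sumZ (fun j : int =>
    let wj := w \o transl (j%:~R *: theta R) in
    expw (wj (Lam m m2 + rho R)) h / odd_factor sg wj h).

(* No term of F^(+-) - r_theta F^(+-) has a pole at h. *)
Definition regular (sg : charsign) (h : H) : Prop :=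
  forall j : int,
    odd_factor sg (transl (j%:~R *: theta R)) h != 0 /\
    odd_factor sg (@refl_theta R \o transl (j%:~R *: theta R)) h != 0.

Definition adm_point (M : nat) (ty : heart) (k1 k2 : int)
    (tau z1 z2 t : C) : H :=
  let b := beta ty k1 k2 in
  let z := zvec z1 z2 in
  hpoint (M%:R * tau) (ybar_inv ty (z + tau *: b))
    (M%:R^-1 * (t + form z b + tau * form b b / 2)).

(* In the next two definitions num sg Lambda is the function
   R^(+-) ch^(+-)_{L(Lambda)} on the Cartan subalgebra, for the irreducible
   highest weight module L(Lambda) and the (super)denominator R^(+-). *)
Definition integrable_numerator (num : charsign -> H -> H -> C)
    (sg : charsign) (m : nat) (m2 : int) : Prop :=
  forall tau z1 z2 t : C, 0 < complex.Im tau ->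
    let h := hpoint tau (zvec z1 z2) t in
    regular sg h ->
    num sg (Lam m m2) h = wF sg m m2 id h - wF sg m m2 (@refl_theta R) h.

Definition admissible_numerator (num : charsign -> H -> H -> C)
    (sg : charsign) (M m : nat) (m2 : int) (ty : heart) (k1 k2 : int) : Prop :=
  forall tau z1 z2 t : C, 0 < complex.Im tau ->
    let h := adm_point M ty k1 k2 tau z1 z2 t in
    regular sg h ->
    num sg (Lam_adm M m m2 ty k1 k2) (hpoint tau (zvec z1 z2) t) =
    num sg (Lam m m2) h.

Definition cfactor (sg : charsign) (m2 : int) : C :=
  if sg is Plus then (-1) ^ (m2 + 1) else 1.

Definition epsilon (sg : charsign) : C := if sg is Plus then 1 / 2 else 0.

End Characters.

(* Main.v *)
Require Import Defs.
From mathcomp Require Import all_boot all_order all_algebra.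
From mathcomp Require Import complex.
From mathcomp Require Import all_classical all_reals all_analysis.
From mathcomp Require Import finmap showcase.summability ring.

Import Order.TTheory GRing.Theory Num.Theory.
Import numFieldNormedType.Exports.
Local Open Scope ring_scope.
Local Open Scope complex_scope.

(** The substitution that defines the numerator of an admissible module sends
    [(tau, z1, z2, t)] to a point with coordinates [(M tau, w1, w2, t')], and
    [ybar] acts on the coordinates [(z1, z2)] only by swapping them and changing
    signs ([ybar_inv_zvec]).  So all four types come from one formula for the
    numerator of [L(Lam m m2)] at an arbitrary point ([numeratorE]), in which
    [w1], [w2] and [t'] are then replaced by their values; the prefactor is
    [e2pi (m t')], since [(z|beta)] and [(beta|beta)] are explicit ([form_zvec]).

    That formula holds term by term.  At [(T, w1, w2, t)] the [j]-th term of [F],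
    with [j] replaced by [- j], is
      [e2pi (m t) * e2pi (m j (w1 - w2) + s w1 + T (m j^2 + s j))
       / (1 +- e2pi (w1 + T j))^2]   where [s = 1 - m2],
    which is the [j]-th term of [Phi1] at [(w1, - w2)] when the sign is [-].  For
    the sign [+], adding [1/2] to [w1] and to [w2] turns [1 + e2pi w1] into
    [1 - e2pi w1] and multiplies the term by [(-1)^s]; the factor [cfactor]
    compensates for it ([cfactor_epsilon]).  This is [wF_idE].

    The reflection [refl_theta] is an isometry that exchanges [w1] and [w2], so
    [refl_theta F] is [F] at the swapped point ([wF_refl_theta]).  As [Phi2] at
    [(u1, u2)] is [Phi1] at [(- u2, - u1)] ([Phi2_Phi1]), this second part of the
    numerator is the [Phi2] part of [Phi]. *)

(** * Unconditional sums *)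

Section Sums.
#[local] Existing Instance totally_filter.
Local Open Scope classical_set_scope.
Local Open Scope fset_scope.

Lemma partial_sum_reindex (I : choiceType) (V : zmodType) (f : I -> V)
    (s : I -> I) (A : {fset I}) : injective s ->
  partial_sum (f \o s) A = partial_sum f [fset s i | i in A].
Proof.
move=> s_inj; rewrite /partial_sum.
rewrite -(big_seq_fsetE _ A predT (f \o s)) -(big_seq_fsetE _ _ predT f) /=.
by rewrite big_imfset //= => i j _ _; apply: s_inj.
Qed.

(** A bijection of the index set permutes the finite subsets and preserves their
    inclusions, so both families of partial sums generate the same filter: the
    limits agree even when they do not converge. *)
Lemma sum_reindex (I : choiceType) (K : numDomainType) (V : normedModType K)
    (f : I -> V) (s s' : I -> I) :
  cancel s s' -> cancel s' s ->
  summability.sum (f \o s) = summability.sum f.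
Proof.
move=> sK s'K; rewrite /summability.sum; congr (lim _).
have im_s'K (A : {fset I}) : [fset s i | i in [fset s' i | i in A]] = A.
  apply/fsetP => i; apply/imfsetP/idP => /= [[_ /imfsetP[j /= Aj ->] ->]|Ai].
    by rewrite s'K.
  by exists (s' i); rewrite ?s'K //; apply: in_imfset.
have im_sK (A : {fset I}) : [fset s' i | i in [fset s i | i in A]] = A.
  apply/fsetP => i; apply/imfsetP/idP => /= [[_ /imfsetP[j /= Aj ->] ->]|Ai].
    by rewrite sK.
  by exists (s i); rewrite ?sK //; apply: in_imfset.
apply/seteqP; split=> P [A _ subAP].
- exists [fset s i | i in A] => //= B subAB.
  rewrite /= -(im_s'K B) -partial_sum_reindex; last exact: can_inj sK.
  by apply: subAP; rewrite /= -(im_sK A); apply: subset_imfset; apply/fsubsetP.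
- exists [fset s' i | i in A] => //= B subAB.
  rewrite /= partial_sum_reindex; last exact: can_inj sK.
  by apply: subAP; rewrite /= -(im_s'K A); apply: subset_imfset; apply/fsubsetP.
Qed.

Lemma sumZ_opp (R : realType) (f : int -> R[i]) :
  sumZ (fun j => f (- j)) = sumZ f.
Proof. exact: (@sum_reindex int R[i] R[i]^o f -%R -%R opprK opprK). Qed.

(** If [f] is not summable and [a != 0], then [a * f] is not summable either, and
    both sums are the default point of the complex numbers, which is [0]. *)
Lemma sumZ_scale (R : realType) (a : R[i]) (f : int -> R[i]) :
  sumZ (fun j => a * f j) = a * sumZ f.
Proof.
pose S (g : int -> R[i]) : {fset int} -> R[i]^o := @partial_sum int R[i]^o g.
have Sscale b g : S (fun j => b * g j) = (fun A => b *: S g A).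
  apply/funext => A; exact/esym/mulr_sumr.
have cvgS b g : cvg (S g @ totally) -> cvg (S (fun j => b * g j) @ totally).
  by move=> Sg; rewrite Sscale; apply: is_cvgZl_tmp.
change (lim (S (fun j => a * f j) @ totally) = a * lim (S f @ totally)).
have [Sf|dSf] := pselect (cvg (S f @ totally)).
  rewrite Sscale; apply: (@cvg_lim _ (@norm_hausdorff _ R[i]^o)).
  exact: cvgZl_tmp.
have [->|a0] := eqVneq a 0.
  rewrite mul0r Sscale; apply: (@cvg_lim _ (@norm_hausdorff _ R[i]^o)).
  under eq_fun do rewrite scale0r.
  exact: cvg_cst.
have dSaf : ~ cvg (S (fun j => a * f j) @ totally).
  move=> /(cvgS a^-1).
  rewrite (_ : (fun j => a^-1 * (a * f j)) = f) //.
  by apply/funext => j; rewrite mulKf.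
rewrite (dvgP dSaf) (dvgP dSf); exact/esym/mulr0.
Qed.

End Sums.

(** * The exponential and the half-period shift *)

Section Exponential.
Context {R : realType}.
Local Notation C := R[i].

Lemma cexpD (x y : C) : cexp (x + y) = cexp x * cexp y.
Proof.
case: x y => [a b] [c d]; rewrite /cexp /= expRD cosD sinD.
by apply/eqP; rewrite eq_complex /=; apply/andP; split; apply/eqP; ring.
Qed.

Lemma e2piD (x y : C) : e2pi (x + y) = e2pi x * e2pi y.
Proof. by rewrite /e2pi mulrDr cexpD. Qed.

Lemma e2pi0 : e2pi (0 : C) = 1.
Proof.
rewrite /e2pi mulr0 /cexp /= expR0 cos0 sin0.
by apply/eqP; rewrite eq_complex /=; apply/andP; split; apply/eqP; ring.
Qed.

Lemma e2piN (x : C) : e2pi (- x) = (e2pi x)^-1.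
Proof.
have ex : e2pi (- x) * e2pi x = 1 by rewrite -e2piD addNr e2pi0.
have ex0 : e2pi x != 0.
  by apply: contra_eq_neq ex => ->; rewrite mulr0 eq_sym oner_eq0.
by apply: (mulIf ex0); rewrite ex mulVf.
Qed.

Lemma e2piMz (n : int) (x : C) : e2pi (n%:~R * x) = e2pi x ^ n.
Proof.
have e2piMn (k : nat) : e2pi (k%:~R * x) = e2pi x ^+ k.
  elim: k => [|k IHk].
    by rewrite (_ : 0%:~R * x = 0) ?e2pi0 //; apply: mul0r.
  by rewrite -addn1 PoszD intrD mulrDl mul1r e2piD IHk addn1 exprSr.
case: n => k; first exact: e2piMn.
by rewrite NegzE mulrNz mulNr e2piN e2piMn exprnN.
Qed.

Lemma e2pi_half : e2pi (1 / 2 : C) = -1.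
Proof.
have -> : e2pi (1 / 2 : C) = cexp (0 +i* pi).
  rewrite /e2pi /twopii; congr cexp.
  rewrite (_ : 2 * pi = pi + pi); last by ring.
  rewrite rmorphD /=; apply/eqP.
  rewrite (_ : 0 +i* pi = pi%:C * 'i); first by apply/eqP; field.
  by apply/eqP; rewrite eq_complex /=; apply/andP; split; apply/eqP; ring.
rewrite /cexp /= expR0 cospi sinpi.
by apply/eqP; rewrite eq_complex /=; apply/andP; split; apply/eqP; ring.
Qed.

Lemma e2pi_epsilon sg : e2pi (epsilon R sg) = - sgnC R sg.
Proof. by case: sg; rewrite /= ?e2pi_half // e2pi0 opprK. Qed.

(** With [s = - m2 + 1], shifting [z1] by [epsilon] and [z2] by [- epsilon] brings
    [e2pi (s * epsilon)] into each term of [Phi1].  For the sign [+] this is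
    [(-1)^s], and [s] has the parity of [m2 + 1]. *)
Lemma cfactor_epsilon sg (m2 : int) :
  cfactor R sg m2 * e2pi ((- m2 + 1)%:~R * epsilon R sg) = 1.
Proof.
rewrite e2piMz e2pi_epsilon; case: sg => /=; last by rewrite opprK exp1rz mul1r.
rewrite -expfzDr ?oppr_eq0 ?oner_eq0 //.
by rewrite (_ : m2 + 1 + (- m2 + 1) = 2) ?sqrrN ?expr1n //; ring.
Qed.

End Exponential.

(** * The numerator of the integrable module *)

Section Numerator.
Context {R : realType}.
Local Notation C := R[i].

(** With this explicit expression every identity between weights reduces to an
    identity of rational functions in their coordinates. *)
Lemma form_coord (x y : 'rV[C]_4) :
  Defs.form x y = x 0 0 * (2 * y 0 0 - y 0 1 + y 0 3) + x 0 1 * (y 0 2 - y 0 0)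
    + x 0 2 * (y 0 1 - 2 * y 0 2) + x 0 3 * y 0 0.
Proof.
rewrite /Defs.form mxE !big_ord_recl big_ord0 !mxE.
rewrite !big_ord_recl !big_ord0 !mxE /=.
have e1 : lift 0 0 = 1 :> 'I_4 by apply/val_inj.
have e2 : lift 0 (lift 0 0) = 2 :> 'I_4 by apply/val_inj.
have e3 : lift 0 (lift 0 (lift 0 0)) = 3 :> 'I_4 by apply/val_inj.
rewrite !e1 !e2 !e3 /=.
ring.
Qed.

Lemma expwE (lam : 'rV[C]_4) (T w1 w2 t : C) :
  expw lam (hpoint T (zvec w1 w2) t) =
  e2pi (lam 0 0 * (w1 - w2 - T) - lam 0 1 * w1 + lam 0 2 * (w1 + w2)
        + lam 0 3 * t).
Proof.
by rewrite /expw /e2pi form_coord; congr cexp; rewrite !mxE /=; field.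
Qed.

Lemma transl_theta (a : C) (lam : 'rV[C]_4) :
  transl (a *: theta R) lam =
  lam + (a * lam 0 3) *: theta R
  - (a ^+ 2 * lam 0 3 + a * (lam 0 1 - 2 * lam 0 0)) *: delta R.
Proof.
have theta2 : Defs.form (theta R) (theta R) = 2.
  by rewrite form_coord !mxE /=; ring.
have lam_theta : Defs.form lam (theta R) = lam 0 1 - 2 * lam 0 0.
  by rewrite form_coord !mxE /=; ring.
have lam_delta : Defs.form lam (delta R) = lam 0 3.
  by rewrite form_coord !mxE /=; ring.
rewrite /transl !Defs.formZl !Defs.formZr theta2 lam_theta lam_delta scalerA.
by congr (_ + _ *: _ - _ *: _); field.
Qed.

Lemma expw_transl (a : C) (lam : 'rV[C]_4) (T w1 w2 t : C) :
  expw (transl (a *: theta R) lam) (hpoint T (zvec w1 w2) t) =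
  e2pi (lam 0 0 * (w1 - w2 - T) - lam 0 1 * w1 + lam 0 2 * (w1 + w2)
        + lam 0 3 * t - a * lam 0 3 * (w1 - w2)
        + T * (a ^+ 2 * lam 0 3 + a * (lam 0 1 - 2 * lam 0 0))).
Proof. by rewrite transl_theta expwE; congr e2pi; rewrite !mxE /=; ring. Qed.

Lemma expw_orbit (m : nat) (m2 j : int) (T w1 w2 t : C) :
  expw (transl (j%:~R *: theta R) (Lam R m m2 + rho R))
    (hpoint T (zvec w1 w2) t) =
  e2pi (m%:R * t - m%:R * j%:~R * (w1 - w2) + (1 - m2%:~R) * w1
        + T * (m%:R * j%:~R ^+ 2 - (1 - m2%:~R) * j%:~R)).
Proof.
have top0 : (Lam R m m2 + rho R : 'rV_4) 0 0 = 0 by rewrite !mxE /=; ring.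
have top1 : (Lam R m m2 + rho R : 'rV_4) 0 1 = m2%:~R - 1.
  by rewrite !mxE /=; field.
have top2 : (Lam R m m2 + rho R : 'rV_4) 0 2 = 0 by rewrite !mxE /=; ring.
have top3 : (Lam R m m2 + rho R : 'rV_4) 0 3 = m%:R by rewrite !mxE /=; ring.
by rewrite expw_transl top0 top1 top2 top3; congr e2pi; ring.
Qed.

(** Each factor of the denominator of [F] occurs twice, because [alpha3] is
    [alpha1]: this is where the double poles of [Phi] come from. *)
Lemma expw_odd (j : int) (T w1 w2 t : C) :
  expw (- transl (j%:~R *: theta R) (alpha1 R)) (hpoint T (zvec w1 w2) t) =
  e2pi (w1 - T * j%:~R).
Proof. by rewrite transl_theta expwE; congr e2pi; rewrite !mxE /=; ring. Qed.

(** The terms agree up to [j -> - j]: the translation [t_(j theta)] lowers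
    [alpha1] by [j delta], whereas the denominators of [Phi1] carry [q^j]. *)
Lemma wF_idE sg (m : nat) (m2 : int) (T w1 w2 t : C) :
  wF sg m m2 id (hpoint T (zvec w1 w2) t) =
  cfactor R sg m2 * e2pi (m%:R * t) *
  Phi1 m (- m2 + 1) T (w1 + epsilon R sg) (- w2 - epsilon R sg) 0.
Proof.
rewrite /wF /Phi1 mulr0 oppr0 e2pi0 mul1r -[sumZ _ in LHS]sumZ_opp -sumZ_scale.
congr sumZ; apply/funext => j /=; rewrite /odd_factor /alpha3 /=.
rewrite expw_orbit expw_odd -expr2 mulrA; congr (_ / _ ^+ 2); last first.
  rewrite (e2piD w1 (epsilon R sg)) e2pi_epsilon mulrNz mulrN opprK e2piD.
  by ring.
set s := (- m2 + 1)%:~R.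
have -> : m%:R * j%:~R * (w1 + epsilon R sg + (- w2 - epsilon R sg))
    + s * (w1 + epsilon R sg)
  = m%:R * j%:~R * (w1 - w2) + s * w1 + s * epsilon R sg by ring.
rewrite (e2piD _ (s * epsilon R sg)).
(* The half-period shift contributes [v] to the term; [cfactor] cancels it. *)
have : forall c u v x y : C, c * v = 1 -> c * u * (x * v * y) = u * x * y.
  by move=> c u v x y cv1; rewrite -[RHS]mul1r -cv1; ring.
move=> ->; last exact: cfactor_epsilon.
by rewrite -!e2piD; congr e2pi; rewrite /s; ring.
Qed.

(** [refl_theta] is self-adjoint for the form, so it can be moved from the weights
    to the point, where it exchanges the two coordinates of [z]. *)
Lemma wF_refl_theta sg (m : nat) (m2 : int) (T w1 w2 t : C) :
  wF sg m m2 (@refl_theta R) (hpoint T (zvec w1 w2) t) =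
  wF sg m m2 id (hpoint T (zvec w2 w1) t).
Proof.
have refl_swap lam : expw (refl_theta lam) (hpoint T (zvec w1 w2) t)
    = expw lam (hpoint T (zvec w2 w1) t).
  by rewrite !expwE; congr e2pi; rewrite !mxE !form_coord !mxE /=; field.
have refl_swapN lam : expw (- refl_theta lam) (hpoint T (zvec w1 w2) t)
    = expw (- lam) (hpoint T (zvec w2 w1) t).
  by rewrite -refl_swap /refl_theta Defs.formNl scaleNr opprB opprK addrC.
have term_swap w lam :
    expw ((@refl_theta R \o w) lam) (hpoint T (zvec w1 w2) t)
      / odd_factor sg (@refl_theta R \o w) (hpoint T (zvec w1 w2) t)
    = expw (w lam) (hpoint T (zvec w2 w1) t)
      / odd_factor sg w (hpoint T (zvec w2 w1) t).
  by rewrite /odd_factor /= refl_swap !refl_swapN.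
by apply: (f_equal (@sumZ R)); apply/funext => j; apply: term_swap.
Qed.

Lemma Phi2_Phi1 (m : nat) (s : int) (T u1 u2 t : C) :
  Phi2 m s T u1 u2 t = Phi1 m s T (- u2) (- u1) t.
Proof.
congr (_ * sumZ _); apply/funext => j.
by congr (e2pi _ * _ / _); ring.
Qed.

Lemma numeratorE num sg (m : nat) (m2 : int) (T w1 w2 t : C) :
  integrable_numerator num sg m m2 -> 0 < complex.Im T ->
  regular sg (hpoint T (zvec w1 w2) t) ->
  num sg (Lam R m m2) (hpoint T (zvec w1 w2) t) =
  cfactor R sg m2 * e2pi (m%:R * t) *
  Phi m (- m2 + 1) T (w1 + epsilon R sg) (- w2 - epsilon R sg) 0.
Proof.
move=> hint T_gt0 hreg; rewrite (hint _ _ _ _ T_gt0 hreg).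
rewrite /Phi Phi2_Phi1 mulrBr !opprD !opprK; congr (_ - _); first exact: wF_idE.
by rewrite wF_refl_theta wF_idE.
Qed.

(** * The substitution for admissible weights *)

Lemma ybar_inv_zvec ty (w1 w2 : C) :
  ybar_inv ty (zvec w1 w2) =
  match ty with
  | TypeI => zvec w1 w2
  | TypeII => zvec (- w1) (- w2)
  | TypeIII => zvec (- w2) (- w1)
  | TypeIV => zvec w2 w1
  end.
Proof.
have refl_thetaE u1 u2 : refl_theta (zvec u1 u2) = zvec u2 u1 :> cartan R.
  apply/rowP => i; rewrite !mxE form_coord !mxE /=.
  by case: i => [[|[|[|[|//]]]] ?] /=; field.
have refl_alpha2E u1 u2 :
    refl_alpha2 (zvec u1 u2) = zvec (- u2) (- u1) :> cartan R.
  apply/rowP => i; rewrite !mxE form_coord !mxE /=.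
  by case: i => [[|[|[|[|//]]]] ?] /=; field.
by case: ty => /=; rewrite ?refl_thetaE ?refl_alpha2E.
Qed.

Lemma zvecD (a b1 b2 u1 u2 : C) :
  zvec u1 u2 + a *: zvec b1 b2 = zvec (u1 + a * b1) (u2 + a * b2).
Proof. by apply/rowP => i; rewrite !mxE; field. Qed.

Lemma form_zvec (u1 u2 b1 b2 : C) :
  Defs.form (zvec u1 u2) (zvec b1 b2) = - (u1 * b2 + u2 * b1).
Proof. by rewrite form_coord !mxE /=; field. Qed.

End Numerator.

Theorem proposition4p2 (R : realType)
  (num : charsign -> cartan R -> cartan R -> R[i])
  (M m : nat) (hM : (0 < M)%N) (hm : (0 < m)%N) (hMm : coprime M m)
  (m2 : int) (hm2 : 0 <= m2 <= m%:Z)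
  (ty : heart) (k1 k2 : int) (hk : in_range ty M k1 k2)
  (sg : charsign)
  (hint : integrable_numerator num sg m m2)
  (hadm : admissible_numerator num sg M m m2 ty k1 k2)
  (tau z1 z2 t : R[i]) (htau : 0 < complex.Im tau)
  (hreg : regular sg (adm_point M ty k1 k2 tau z1 z2 t)) :
  let N := num sg (Lam_adm R M m m2 ty k1 k2) (hpoint tau (zvec z1 z2) t) in
  let c := cfactor R sg m2 in
  let eps := epsilon R sg in
  let K1 : R[i] := k1%:~R in
  let K2 : R[i] := k2%:~R in
  let r : R[i] := m%:R / M%:R in
  match ty with
  | TypeI =>
      N = c * e2pi (r * (t + (K1 + K2) * z1 - K1 * z2))
        * e2pi (tau * (r * K1 * (K1 + K2)))
        * Phi m (- m2 + 1) (M%:R * tau)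
            (z1 + K1 * tau + eps) (- z2 + (K1 + K2) * tau - eps) 0
  | TypeII =>
      N = c * e2pi (r * (t - (K1 + K2) * z1 + K1 * z2))
        * e2pi (tau * (r * K1 * (K1 + K2)))
        * Phi m (- m2 + 1) (M%:R * tau)
            (- z1 + K1 * tau + eps) (z2 + (K1 + K2) * tau - eps) 0
  | TypeIII =>
      N = c * e2pi (r * (t + K1 * z1 - (K1 + K2) * z2))
        * e2pi (tau * (r * K1 * (K1 + K2)))
        * Phi m (- m2 + 1) (M%:R * tau)
            (- z2 + K1 * tau + eps) (z1 + (K1 + K2) * tau - eps) 0
  | TypeIV =>
      N = c * e2pi (r * (t - K1 * z1 + (K1 + K2) * z2))
        * e2pi (tau * (r * K1 * (K1 + K2)))
        * Phi m (- m2 + 1) (M%:R * tau)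
            (z2 + K1 * tau + eps) (- z1 + (K1 + K2) * tau - eps) 0
  end.
Proof.
move=> N c eps K1 K2 r.
have M0 : M%:R != 0 :> R[i] by rewrite pnatr_eq0 -lt0n.
have Mtau : 0 < complex.Im (M%:R * tau).
  have -> : complex.Im (M%:R * tau) = M%:R * complex.Im tau.
    rewrite -(rmorph_nat (real_complex R)) /=.
    by case: tau {htau hreg hadm N} => a b /=; rewrite mul0r addr0.
  by rewrite mulr_gt0 // ltr0n.
rewrite {}/N (hadm _ _ _ _ htau hreg) {hadm}; move: hreg.
(* What is left of each type is the exponent of the prefactor, i.e. [m t'], and
   the two arguments [w1 + eps] and [- w2 - eps] of [Phi]. *)
case: ty hk => hk;
  rewrite /adm_point /beta zvecD ybar_inv_zvec !form_zvec => hreg;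
  rewrite (numeratorE _ _ _ _ _ _ _ _ hint Mtau hreg);
  rewrite -[_ * e2pi _ * e2pi _]mulrA -e2piD;
  congr (_ * e2pi _ * Phi _ _ _ _ _ _);
  rewrite ?mulrNz ?intrD -/K1 -/K2 /r /eps; by field.
Qed.
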